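(* Let there be given the function $\varphi(x)=\frac23\sin x+\frac13\tan x=\sum_{k=0}^{\infty}a_kx^{2k+1}:\left(0,\frac{\pi}{2}\right)\to\mathbb{R}$, with coefficients $$a_k=\frac{2(-1)^k}{3(2k+1)!}+\frac{2^{2k+2}(2^{2k+2}-1)|\mathbf{B}_{2k+2}|}{3(2k+2)!}\qquad(k\in\mathbb{N}_0).$$ Let $c\in\left(0,\frac{\pi}{2}\right)$ be fixed. Then for $x\in(0,c)$ it holds: $$\begin{array}{c}T_0^{\varphi,0+}(x)<\ldots<T_n^{\varphi,0+}(x)<T_{n+1}^{\varphi,0+}(x)<\ldots\\[1ex] \ldots<\frac23\sin x+\frac13\tan x<\ldots\\[1ex] \ldots<\mathbb{T}_{n+1}^{\varphi;0+,c-}(x)<\mathbb{T}_n^{\varphi;0+,c-}(x)<\ldots<\mathbb{T}_0^{\varphi;0+,c-}(x).\end{array}$$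
   Context: $\mathbf{B}_k$ denotes the $k$-th Bernoulli number and $\mathbb{N}_0=\{0,1,2,\ldots\}$. For $n\in\mathbb{N}_0$, the first Taylor approximation of $\varphi$ in the right neighbourhood of $0$ is the Taylor polynomial of order $n$, $$T_n^{\varphi,0+}(x)=\sum_{k=0}^n\frac{\varphi^{(k)}(0+)}{k!}x^k,\qquad \varphi^{(k)}(0+)=\lim_{x\to0+}\varphi^{(k)}(x).$$ The second Taylor approximation of $\varphi$ in the right neighbourhood of $0$, on the interval $(0,c)$, is $$\mathbb{T}_n^{\varphi;0+,c-}(x)=T_{n-1}^{\varphi,0+}(x)+\frac{\varphi(c-)-T_{n-1}^{\varphi,0+}(c)}{c^n}\,x^n\quad(n\ge1),\qquad \mathbb{T}_0^{\varphi;0+,c-}(x)=\varphi(c-),$$ where $\varphi(c-)=\lim_{x\to c-}\varphi(x)=\varphi(c)$.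
   Formalization: The strict chain T_n < T_{n+1} fails for some n, since φ is odd and a_1 = 0 (so T_1 = T_2 = T_3 = T_4); it is replaced by T_n ≤ T_{n+1} for all n, with strict inequality exactly when n is even and n ≠ 2. *)

(* Defs.v *)
(* Stdlib reals and Coquelicot. *)
From Stdlib Require Import Reals Arith Factorial Lra Lia.
From Coquelicot Require Import Coquelicot.
Open Scope R_scope.

(* [iota] picks the unique real with the given property; when the one-sided
   limit does not exist the value is unspecified. *)
Definition right_lim (f : R -> R) (a : R) : R :=
  iota (fun l : R => filterlim f (at_right a) (locally l)).

Definition left_lim (f : R -> R) (a : R) : R :=
  iota (fun l : R => filterlim f (at_left a) (locally l)).

Lemma right_lim_correct (f : R -> R) (a l : R) :
  filterlim f (at_right a) (locally l) -> right_lim f a = l.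
Proof.
intros H; apply (iota_filterlim_locally (V := R_CompleteNormedModule)).
exact H.
Qed.

Lemma left_lim_correct (f : R -> R) (a l : R) :
  filterlim f (at_left a) (locally l) -> left_lim f a = l.
Proof.
intros H; apply (iota_filterlim_locally (V := R_CompleteNormedModule)).
exact H.
Qed.

(* [sum_n u n] has n+1 terms, u 0 + ... + u n. *)
Definition taylor_first (f : R -> R) (n : nat) (x : R) : R :=
  sum_n (fun k => right_lim (Derive_n f k) 0 / INR (fact k) * x ^ k) n.

Definition taylor_second (f : R -> R) (c : R) (n : nat) (x : R) : R :=
  match n with
  | O => left_lim f c
  | S m => taylor_first f m x
           + (left_lim f c - taylor_first f m c) / c ^ n * x ^ n
  end.

(* [bernoulli_upto n k] is B_k for k <= n; the recursion solves
   sum_(k <= n) C(n+1,k) B_k = 0 (n >= 1) for B_n. *)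
Fixpoint bernoulli_upto (n : nat) : nat -> R :=
  match n with
  | O => fun _ => 1
  | S m => fun k =>
      if Nat.eqb k n
      then - sum_f_R0 (fun j => Binomial.C (S n) j * bernoulli_upto m j) m
           / INR (S n)
      else bernoulli_upto m k
  end.

Definition bernoulli (n : nat) : R := bernoulli_upto n n.

Lemma bernoulli_upto_stable (n k : nat) :
  (k <= n)%nat -> bernoulli_upto n k = bernoulli k.
Proof.
induction n as [|n IH]; intros Hk.
- now replace k with 0%nat by lia.
- destruct (Nat.eq_dec k (S n)) as [->|Hne]; [reflexivity|].
  cbn [bernoulli_upto]; destruct (Nat.eqb_spec k (S n)); [easy|].
  apply IH; lia.
Qed.

Lemma bernoulli_0 : bernoulli 0 = 1.
Proof. reflexivity. Qed.

Lemma bernoulli_rec (n : nat) : (1 <= n)%nat ->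
  sum_f_R0 (fun k => Binomial.C (S n) k * bernoulli k) n = 0.
Proof.
destruct n as [|n]; [lia|]; intros _.
rewrite tech5.
assert (E : bernoulli (S n) =
  - sum_f_R0 (fun k => Binomial.C (S (S n)) k * bernoulli k) n
    / INR (S (S n))).
{ unfold bernoulli at 1; cbn [bernoulli_upto]; rewrite Nat.eqb_refl.
  do 2 f_equal; apply sum_eq; intros i Hi.
  now rewrite bernoulli_upto_stable. }
rewrite E.
assert (HC : Binomial.C (S (S n)) (S n) = INR (S (S n))).
{ unfold Binomial.C; replace (S (S n) - S n)%nat with 1%nat by lia.
  rewrite (fact_simpl (S n)), mult_INR; simpl (INR (fact 1)).
  field; apply INR_fact_neq_0. }
rewrite HC; field; apply not_0_INR; lia.
Qed.

Definition phi (x : R) : R := 2 / 3 * sin x + 1 / 3 * tan x.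

(* The coefficient of x^(2k+1) in phi. It is positive except for
   phi_coef 1 = 0, so the Taylor polynomials of degree 2k+1 and 2k+2, and
   those of degree 1 to 4, coincide. *)
Definition phi_coef (k : nat) : R :=
  2 * (-1) ^ k / (3 * INR (fact (2 * k + 1)))
  + 2 ^ (2 * k + 2) * (2 ^ (2 * k + 2) - 1) * Rabs (bernoulli (2 * k + 2))
    / (3 * INR (fact (2 * k + 2))).

(* Main.v *)
Require Import Defs.
From Stdlib Require Import Reals Arith Lra Lia.
From Coquelicot Require Import Coquelicot.
Open Scope R_scope.

(** All Maclaurin coefficients of [phi] are nonnegative, and infinitely many
    are positive. This gives everything: each remainder
    [phi x - T_n x] is a series of nonnegative terms, not all zero, hence
    positive, and consecutive Taylor polynomials differ by one such term. With
    [T_(-1) = 0], the second approximation is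
    [T_(n-1)(x) + (phi c - T_(n-1)(c)) * (x / c)^n]. Its excess over [phi x] is
    the series of the [a_(n+k) x^n (c^k - x^k)], and its excess over the next
    second approximation is [(phi c - T_n(c)) * (x / c)^n * (1 - x / c)]; both
    are positive ([phi_lt_taylor_second], [taylor_second_decreasing]).

    The work lies in the series of the tangent. Let [t_n] be defined by the
    recursion that the equation [T' = 1 + T^2], [T(0) = 0] imposes on the
    coefficients of a power series. Then [t_n >= 0], so the partial sums satisfy
    [S' <= 1 + S^2], that is, [(atan S)' <= 1], whence [S <= tan] for
    [0 <= x < PI/2]. The series therefore converges there, its sum satisfies
    [(atan T)' = 1], and so it is [tan] ([is_pseries_tan]).

    The Bernoulli numbers enter through the hyperbolic tangent. The numbers
    [(-1)^(n/2) t_n] satisfy the recursion belonging to [H' = 1 - H^2], so they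
    are the coefficients of [tanh]. With [B(x) = x / (e^x - 1)], the exponential
    generating function of the Bernoulli numbers, one has
    [x tanh x = x - B(2x) + B(4x)], and comparing coefficients expresses
    [(-1)^k t_(2k+1)] by [B_(2k+2)]. Since [t_(2k+1) >= 0], taking absolute
    values yields the formula with [|B_(2k+2)|], with no separate discussion of
    the signs of the Bernoulli numbers ([tan_coef_bernoulli]).

    Finally [a_k] can only be negative through its sine part, which is at most
    [2 / (3 (2k+1)!)] in absolute value. From the recursion,
    [(2k+1)! t_(2k+1) > 2] for all [k >= 2], so the tangent part wins
    ([phi_taylor_coef_pos]). Direct computation gives [a_0 = 1] and [a_1 = 0];
    the latter is why the step from degree 2 to degree 3 is not strict. *)

(** * Power series *)

Lemma CV_radius_gt_of_bounded (a : nat -> R) (x r M : R) :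
  Rabs x < r -> (forall n, Rabs (a n * r ^ n) <= M) ->
  Rbar_lt (Rabs x) (CV_radius a).
Proof.
intros Hx Ha.
apply Rbar_lt_le_trans with (Finite r); [exact Hx|].
apply (proj1 (CV_radius_bounded a)).
now exists M.
Qed.

Lemma CV_radius_gt_of_ex_pseries (a : nat -> R) (x y : R) :
  Rabs x < Rabs y -> ex_pseries a y -> Rbar_lt (Rabs x) (CV_radius a).
Proof.
intros Hxy Hy.
apply Rbar_lt_le_trans with (Finite (Rabs y)); [exact Hxy|].
apply Rbar_not_lt_le; intros Hlt.
apply (CV_disk_outside a y Hlt).
apply ex_series_lim_0.
destruct Hy as [l Hl]; exists l.
now apply is_pseries_R.
Qed.

Lemma is_pseries_monomial (m : nat) (x : R) :
  is_pseries (fun n => if Nat.eqb n m then 1 else 0) x (x ^ m).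
Proof.
apply is_pseries_R.
change (is_lim_seq (sum_n (fun n => (if Nat.eqb n m then 1 else 0) * x ^ n))
          (x ^ m)).
apply (is_lim_seq_ext_loc (fun _ => x ^ m)); [|apply is_lim_seq_const].
exists m; intros n Hn.
induction Hn as [|n Hn IH].
- destruct m as [|m].
  + rewrite sum_O; cbn; ring.
  + rewrite sum_Sn, Nat.eqb_refl.
    rewrite (sum_n_ext_loc _ (fun _ => 0)).
    * rewrite sum_n_const; unfold plus; cbn -[INR]; ring.
    * intros k Hk; destruct (Nat.eqb_spec k (S m)); [lia|apply Rmult_0_l].
- rewrite sum_Sn, <- IH.
  destruct (Nat.eqb_spec (S n) m); [lia|]; unfold plus; cbn; ring.
Qed.

(** The recursion is the coefficientwise form of [F' = 1 + s F^2]. It serves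
    with [s = 1] for the tangent and [s = -1] for the hyperbolic tangent. *)
Lemma is_derive_PSeries_riccati (a : nat -> R) (s x : R) :
  (forall n, INR (S n) * a (S n)
             = (if Nat.eqb n 0 then 1 else 0) + s * PS_mult a a n) ->
  Rbar_lt (Rabs x) (CV_radius a) ->
  is_derive (PSeries a) x (1 + s * PSeries a x ^ 2).
Proof.
intros Ha Hx.
replace (1 + s * PSeries a x ^ 2) with (PSeries (PS_derive a) x);
  [now apply is_derive_PSeries|].
apply is_pseries_unique.
apply (is_pseries_ext
         (PS_plus (fun n => if Nat.eqb n 0 then 1 else 0)
                  (PS_scal s (PS_mult a a)))).
{ intros n; symmetry; exact (Ha n). }
apply (is_pseries_plus (V := R_NormedModule)).
{ exact (is_pseries_monomial 0 x). }
apply (is_pseries_scal (V := R_NormedModule)); [apply Rmult_comm|].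
replace (PSeries a x ^ 2) with (PSeries a x * PSeries a x) by ring.
now apply is_pseries_mult; try apply PSeries_correct, CV_radius_inside.
Qed.

Lemma is_series_odd_terms (u : nat -> R) (l : R) :
  (forall k, u (2 * k)%nat = 0) -> is_series u l ->
  is_series (fun k => u (2 * k + 1)%nat) l.
Proof.
intros Hu Hl.
change (is_lim_seq (sum_n (fun k => u (2 * k + 1)%nat)) l).
apply (is_lim_seq_ext (fun n => sum_n u (2 * n + 1))).
- intros n; induction n as [|n IH].
  + rewrite sum_O, Nat.mul_0_r; change (0 + 1)%nat with 1%nat.
    rewrite sum_Sn, sum_O; replace (u 0%nat) with 0 by now rewrite <- (Hu 0%nat).
    apply Rplus_0_l.
  + rewrite (sum_Sn _ n), <- IH.
    replace (2 * S n + 1)%nat with (S (S (2 * n + 1))) by lia.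
    rewrite 2!sum_Sn.
    replace (S (2 * n + 1)) with (2 * S n)%nat by lia.
    rewrite Hu; unfold plus; cbn -[Nat.mul sum_n]; ring.
- apply (is_lim_seq_subseq (sum_n u) l (fun n => 2 * n + 1)%nat); [|exact Hl].
  apply eventually_subseq; intros n; lia.
Qed.

(** The sum of a series of nonnegative terms is at least the partial sum that
    includes the positive term. *)
Lemma is_series_pos (u : nat -> R) (l : R) (N : nat) :
  is_series u l -> (forall n, 0 <= u n) -> 0 < u N -> 0 < l.
Proof.
intros Hl Hu HN.
assert (Hpos : forall n, 0 <= sum_n u n).
{ intros n; rewrite sum_n_Reals; now apply cond_pos_sum. }
apply Rlt_le_trans with (sum_n u N).
- destruct N as [|N]; [now rewrite sum_O|].
  rewrite sum_Sn; specialize (Hpos N).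
  change (0 < sum_n u N + u (S N)); lra.
- apply (is_lim_seq_incr_compare (sum_n u)); [exact Hl|].
  intros n; rewrite sum_Sn; specialize (Hu (S n)).
  change (sum_n u n <= sum_n u n + u (S n)); lra.
Qed.

(** * The Maclaurin coefficients of the tangent *)

(** Each coefficient depends on all earlier ones, so the recursion carries the
    table of the values already computed. *)
Fixpoint tan_coef_upto (n : nat) : nat -> R :=
  match n with
  | O => fun _ => 0
  | S m => fun k =>
      if Nat.eqb k n
      then ((if Nat.eqb m 0 then 1 else 0)
            + PS_mult (tan_coef_upto m) (tan_coef_upto m) m) / INR n
      else tan_coef_upto m k
  end.

Definition tan_coef (n : nat) : R := tan_coef_upto n n.

Lemma tan_coef_upto_stable (n k : nat) :
  (k <= n)%nat -> tan_coef_upto n k = tan_coef k.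
Proof.
induction n as [|n IH]; intros Hk.
- now replace k with 0%nat by lia.
- destruct (Nat.eq_dec k (S n)) as [->|Hne]; [reflexivity|].
  cbn [tan_coef_upto]; destruct (Nat.eqb_spec k (S n)); [easy|].
  apply IH; lia.
Qed.

Lemma tan_coef_rec (n : nat) :
  INR (S n) * tan_coef (S n)
  = (if Nat.eqb n 0 then 1 else 0) + 1 * PS_mult tan_coef tan_coef n.
Proof.
unfold tan_coef at 1; cbn [tan_coef_upto]; rewrite Nat.eqb_refl.
replace (PS_mult (tan_coef_upto n) (tan_coef_upto n) n)
  with (PS_mult tan_coef tan_coef n).
- field; apply not_0_INR; lia.
- apply sum_eq; intros i Hi.
  rewrite !tan_coef_upto_stable by lia; reflexivity.
Qed.

Lemma tan_coef_ge_0 (n : nat) : 0 <= tan_coef n.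
Proof.
induction n as [[|n] IH] using (well_founded_induction lt_wf).
- apply Rle_refl.
- assert (Hn : 0 < INR (S n)) by (apply lt_0_INR; lia).
  apply Rmult_le_reg_l with (INR (S n)); [exact Hn|].
  rewrite Rmult_0_r, tan_coef_rec, Rmult_1_l.
  apply Rplus_le_le_0_compat; [destruct Nat.eqb; lra|].
  unfold PS_mult.
  rewrite <- (Rmult_0_l (INR (S n))), <- sum_cte.
  apply sum_Rle; intros i Hi.
  apply Rmult_le_pos; apply IH; lia.
Qed.

(** In [t_i t_(n-i)] with [n] odd, one of the two indices is even. *)
Lemma tan_coef_even (n : nat) : Nat.Even n -> tan_coef n = 0.
Proof.
induction n as [[|n] IH] using (well_founded_induction lt_wf); intros Hn.
- reflexivity.
- apply Rmult_eq_reg_l with (INR (S n)); [|apply not_0_INR; lia].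
  rewrite Rmult_0_r, tan_coef_rec.
  destruct (Nat.eqb_spec n 0) as [->|_]; [destruct Hn; lia|].
  rewrite Rplus_0_l, Rmult_1_l.
  transitivity (sum_f_R0 (fun _ => 0) n); [|rewrite sum_cte; ring].
  apply sum_eq; intros i Hi.
  destruct (Nat.Even_or_Odd i) as [Ei|[j Oi]].
  + rewrite (IH i) by (try exact Ei; lia); ring.
  + rewrite (IH (n - i)%nat); [ring|lia|].
    destruct Hn as [m Hm]; exists (m - j - 1)%nat; lia.
Qed.

Lemma is_derive_atan_comp_sub_id (F : R -> R) (y d : R) :
  is_derive F y d ->
  is_derive (fun z => atan (F z) - z) y (d / (1 + F y ^ 2) - 1).
Proof.
intros Hd.
replace (1 + F y ^ 2) with (1 + (F y)²) by (unfold Rsqr; ring).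
refine (is_derive_minus (V := R_NormedModule) (fun z => atan (F z)) (fun z => z)
          y _ 1 _ (is_derive_id y)).
exact (is_derive_comp atan F y _ d (is_derive_atan (F y)) Hd).
Qed.

(** The partial sum [psum] is a subsolution of the tangent's equation:
    differentiating it and using the recursion gives [1] plus the part of degree
    at most [N] of [psum^2], and the terms of [psum^2] left out are nonnegative.
    Hence [atan (psum x) - x] decreases from [0]. *)
Lemma tan_partial_sum_le (N : nat) (x : R) :
  0 <= x < PI / 2 -> sum_f_R0 (fun k => tan_coef k * x ^ k) (S N) <= tan x.
Proof.
intros Hx.
set (psum := fun y => sum_f_R0 (fun k => tan_coef k * y ^ k) (S N)).
set (dpsum := fun y => sum_f_R0 (fun k => INR (S k) * tan_coef (S k) * y ^ k) N).
assert (Hdpsum : forall y, is_derive psum y (dpsum y)).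
{ intros y; unfold psum, dpsum; clear.
  induction N as [|N IH].
  - cbn -[tan_coef]; auto_derive; [easy|ring].
  - rewrite tech5.
    apply (is_derive_ext (fun y =>
        plus (sum_f_R0 (fun k => tan_coef k * y ^ k) (S N))
        (tan_coef (S (S N)) * y ^ S (S N)))).
    { intros t; symmetry; exact (tech5 _ (S N)). }
    refine (is_derive_plus (V := R_NormedModule) _ _ y _ _ IH _).
    auto_derive; [easy|].
    rewrite !S_INR; destruct N; cbn; ring. }
assert (Hle : forall y, 0 <= y -> dpsum y <= 1 + psum y ^ 2).
{ intros y Hy.
  assert (Hnn : forall k, 0 <= tan_coef k * y ^ k).
  { intros k; apply Rmult_le_pos; [apply tan_coef_ge_0|now apply pow_le]. }
  unfold psum; replace (_ ^ 2) with
    (sum_f_R0 (fun k => tan_coef k * y ^ k) (S N)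
     * sum_f_R0 (fun k => tan_coef k * y ^ k) (S N)) by ring.
  rewrite cauchy_finite by lia.
  assert (E : dpsum y = 1 + sum_f_R0 (fun k => sum_f_R0 (fun p =>
      tan_coef p * y ^ p * (tan_coef (k - p) * y ^ (k - p))) k) N).
  { transitivity (sum_f_R0 (fun k => (if Nat.eqb k 0 then 1 else 0) * y ^ k) N
      + sum_f_R0 (fun k => sum_f_R0 (fun p =>
          tan_coef p * y ^ p * (tan_coef (k - p) * y ^ (k - p))) k) N).
    - rewrite <- plus_sum; apply sum_eq; intros k _.
      rewrite tan_coef_rec, Rmult_1_l, Rmult_plus_distr_r; f_equal.
      unfold PS_mult; rewrite Rmult_comm, scal_sum.
      apply sum_eq; intros i Hi.
      replace (y ^ k) with (y ^ i * y ^ (k - i)); [ring|].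
      rewrite <- pow_add; f_equal; lia.
    - f_equal; clear; induction N as [|N IH]; [cbn; ring|].
      rewrite tech5, IH; cbn -[pow]; ring. }
  rewrite E, (tech5 _ N).
  match goal with |- 1 + ?A <= 1 + (?A + ?B + ?C) =>
    enough (0 <= B /\ 0 <= C) by lra end.
  split; apply cond_pos_sum; intros; [|apply cond_pos_sum; intros];
    now apply Rmult_le_pos. }
assert (Hat : atan (psum x) <= x).
{ destruct (MVT_gen (fun y => atan (psum y) - y) 0 x
              (fun y => dpsum y / (1 + psum y ^ 2) - 1)) as [c [Hc E]].
  - intros y _; now apply is_derive_atan_comp_sub_id.
  - intros y _; apply continuity_pt_filterlim.
    apply (ex_derive_continuous (V := R_NormedModule)
             (fun z => atan (psum z) - z) y).
    exists (dpsum y / (1 + psum y ^ 2) - 1); now apply is_derive_atan_comp_sub_id.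
  - rewrite Rmin_left in Hc by lra.
    assert (E0 : psum 0 = 0).
    { unfold psum; transitivity (sum_f_R0 (fun _ => 0) (S N));
        [|rewrite sum_cte; ring].
      apply sum_eq; intros [|i] _; [unfold tan_coef; cbn; ring|].
      rewrite pow_ne_zero by lia; ring. }
    rewrite E0, atan_0 in E.
    assert (H1 : dpsum c / (1 + psum c ^ 2) <= 1).
    { apply Rle_div_l; [generalize (pow2_ge_0 (psum c)); lra|].
      rewrite Rmult_1_l; apply Hle; lra. }
    nra. }
fold (psum x); rewrite <- (tan_atan (psum x)).
destruct (Rle_lt_or_eq_dec _ _ Hat) as [Hlt|Heq]; [|rewrite Heq; lra].
apply Rlt_le, tan_increasing; [|exact Hlt|lra].
apply atan_bound.
Qed.

Lemma tan_coef_term_le (r : R) (n : nat) :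
  0 <= r < PI / 2 -> tan_coef n * r ^ n <= tan r.
Proof.
intros Hr.
assert (Hnn : forall k, 0 <= tan_coef k * r ^ k).
{ intros k; apply Rmult_le_pos; [apply tan_coef_ge_0|now apply pow_le]. }
eapply Rle_trans; [|exact (tan_partial_sum_le n r Hr)].
rewrite tech5; specialize (Hnn (S n)) as Hn1.
enough (tan_coef n * r ^ n <= sum_f_R0 (fun k => tan_coef k * r ^ k) n) by lra.
destruct n as [|n]; [cbn; lra|].
rewrite tech5; generalize (cond_pos_sum _ n Hnn); lra.
Qed.

(** For [r] between [|x|] and [PI/2] the terms [t_n r^n] stay below [tan r]. *)
Lemma tan_coef_radius (x : R) :
  Rabs x < PI / 2 -> Rbar_lt (Rabs x) (CV_radius tan_coef).
Proof.
intros Hx.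
set (r := (Rabs x + PI / 2) / 2).
generalize (Rabs_pos x); intros H0.
apply CV_radius_gt_of_bounded with r (tan r); [unfold r; lra|].
intros n; rewrite Rabs_pos_eq.
- apply tan_coef_term_le; unfold r; lra.
- apply Rmult_le_pos; [apply tan_coef_ge_0|apply pow_le; unfold r; lra].
Qed.

(** The sum [T] solves [T' = 1 + T^2] with [T(0) = 0], so [atan T(x) - x] is
    constant, equal to [0]. *)
Lemma is_pseries_tan (x : R) : 0 <= x < PI / 2 -> is_pseries tan_coef x (tan x).
Proof.
intros Hx.
replace (tan x) with (PSeries tan_coef x).
{ apply PSeries_correct, CV_radius_inside, tan_coef_radius.
  now rewrite Rabs_pos_eq. }
destruct (MVT_cor4 (fun y => atan (PSeries tan_coef y) - y) (fun _ => 0) 0 x)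
  with (b := x) as [c [E _]].
- intros y Hy; rewrite Rminus_0_r in Hy.
  assert (Hd : is_derive (PSeries tan_coef) y (1 + 1 * PSeries tan_coef y ^ 2)).
  { apply is_derive_PSeries_riccati; [exact tan_coef_rec|].
    apply tan_coef_radius; lra. }
  replace 0 with
    ((1 + 1 * PSeries tan_coef y ^ 2) / (1 + PSeries tan_coef y ^ 2) - 1).
  + now apply is_derive_atan_comp_sub_id.
  + field; generalize (pow2_ge_0 (PSeries tan_coef y)); lra.
- rewrite Rabs_pos_eq; lra.
- rewrite PSeries_0 in E; replace (tan_coef 0) with 0 in E by reflexivity.
  rewrite atan_0 in E.
  rewrite <- (tan_atan (PSeries tan_coef x)); f_equal; lra.
Qed.

(** * Bernoulli numbers and the hyperbolic tangent *)

(** The sign comes from [tanh x = - i tan (i x)]. At even indices [tan_coef]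
    vanishes, so only the values of the sign at odd indices matter. *)
Definition tanh_coef (n : nat) : R := (-1) ^ (Nat.div2 n) * tan_coef n.

(** When [i] and [n - i] are both odd,
    [i/2 + (n - i)/2 + 1 = (n + 1)/2], which turns the sign of each product into
    the opposite of the sign at [n + 1]. *)
Lemma tanh_coef_rec (n : nat) :
  INR (S n) * tanh_coef (S n)
  = (if Nat.eqb n 0 then 1 else 0) + (-1) * PS_mult tanh_coef tanh_coef n.
Proof.
unfold tanh_coef at 1.
replace (INR (S n) * ((-1) ^ Nat.div2 (S n) * tan_coef (S n)))
  with ((-1) ^ Nat.div2 (S n) * (INR (S n) * tan_coef (S n))) by ring.
rewrite tan_coef_rec, Rmult_1_l, Rmult_plus_distr_l; f_equal.
- destruct (Nat.eqb_spec n 0) as [->|_]; cbn; ring.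
- unfold PS_mult; rewrite !scal_sum; apply sum_eq; intros i Hi.
  unfold tanh_coef.
  destruct (Nat.Even_or_Odd i) as [Ei|[j Ej]].
  { rewrite (tan_coef_even i Ei); ring. }
  destruct (Nat.Even_or_Odd (n - i)) as [Ek|[k Ek]].
  { rewrite (tan_coef_even (n - i) Ek); ring. }
  rewrite Ek, Ej.
  replace (S n) with (S (2 * S (j + k))) by lia.
  rewrite !Nat.add_1_r, !Nat.div2_succ_double.
  rewrite <- tech_pow_Rmult, pow_add; ring.
Qed.

Lemma tanh_coef_radius (x : R) :
  Rabs x < PI / 2 -> Rbar_lt (Rabs x) (CV_radius tanh_coef).
Proof.
intros Hx.
set (r := (Rabs x + PI / 2) / 2).
generalize (Rabs_pos x); intros H0.
apply CV_radius_gt_of_bounded with r (tan r); [unfold r; lra|].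
intros n; unfold tanh_coef.
rewrite Rmult_assoc, Rabs_mult, pow_1_abs, Rmult_1_l, Rabs_pos_eq.
- apply tan_coef_term_le; unfold r; lra.
- apply Rmult_le_pos; [apply tan_coef_ge_0|apply pow_le; unfold r; lra].
Qed.

(** The equation [H' = 1 - H^2] makes [(1 + H) / (1 - H) * e^(-2x)] constant
    where [H < 1]. The conclusion is [H = tanh] with denominators cleared. *)
Lemma PSeries_tanh_near_0 :
  locally 0 (fun x : R =>
    PSeries tanh_coef x * (exp (2 * x) + 1) = exp (2 * x) - 1).
Proof.
set (H := PSeries tanh_coef).
assert (HP : 0 < PI / 2) by (generalize PI_RGT_0; lra).
assert (Hc : locally 0 (fun x : R => H x < 1)).
{ assert (C : filterlim H (locally 0) (locally (H 0))).
  { apply continuity_pt_filterlim, PSeries_continuity, tanh_coef_radius.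
    now rewrite Rabs_R0. }
  apply (C (fun y => y < 1)); apply (open_lt 1).
  unfold H; rewrite PSeries_0; unfold tanh_coef, tan_coef; cbn; lra. }
assert (Hr : locally 0 (fun x : R => Rabs x < PI / 2)).
{ exists (mkposreal _ HP); intros y Hy.
  rewrite <- (Rminus_0_r y); exact Hy. }
destruct (filter_and _ _ Hc Hr) as [eps Heps].
exists eps; intros x Hx.
destruct (MVT_cor4 (fun y => (1 + H y) / (1 - H y) * exp (- 2 * y))
            (fun _ => 0) 0 (Rabs x)) with (b := x) as [c [E _]].
- intros y Hy; rewrite Rminus_0_r in Hy.
  destruct (Heps y) as [Hlt Hy2].
  { change (Rabs (y - 0) < eps).
    change (Rabs (x - 0) < eps) in Hx.
    rewrite Rminus_0_r in *; lra. }
  assert (Hd : is_derive H y (1 + (-1) * H y ^ 2)).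
  { apply is_derive_PSeries_riccati; [exact tanh_coef_rec|].
    now apply tanh_coef_radius. }
  auto_derive.
  + repeat split; try (eexists; exact Hd); lra.
  + replace (Derive (fun x => H x) y) with (1 + (-1) * H y ^ 2)
      by (symmetry; exact (is_derive_unique _ _ _ Hd)).
    field; lra.
- rewrite Rminus_0_r; apply Rle_refl.
- assert (H1 : H x < 1) by now apply Heps.
  assert (H0 : H 0 = 0).
  { unfold H; rewrite PSeries_0; unfold tanh_coef, tan_coef; cbn; ring. }
  rewrite H0, Rmult_0_r, exp_0 in E.
  assert (Ee : exp (-2 * x) * exp (2 * x) = 1).
  { rewrite <- exp_plus, <- exp_0; f_equal; ring. }
  assert (E2 : 1 + H x = (1 - H x) * exp (2 * x)).
  { transitivity ((1 + H x) / (1 - H x) * (exp (-2 * x) * exp (2 * x))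
                  * (1 - H x)); [rewrite Ee; field; lra|].
    rewrite <- Rmult_assoc.
    replace ((1 + H x) / (1 - H x) * exp (-2 * x)) with 1 by lra.
    ring. }
  lra.
Qed.

Definition bernoulli_egf (n : nat) : R := bernoulli n / INR (fact n).

(** Coefficients of [(e^x - 1) / x]. *)
Definition expm1_coef : nat -> R :=
  PS_decr_1 (V := R_NormedModule) (fun n => / INR (fact n)).

Lemma PSeries_expm1 (x : R) : x * PSeries expm1_coef x = exp x - 1.
Proof.
rewrite exp_Reals, (PSeries_decr_1 (fun n => / INR (fact n)) x)
  by (eexists; apply is_exp_Reals).
cbn [fact INR]; rewrite Rinv_1; unfold expm1_coef; ring.
Qed.

Lemma expm1_coef_radius (x : R) : Rbar_lt (Rabs x) (CV_radius expm1_coef).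
Proof.
unfold expm1_coef; rewrite CV_radius_decr_1.
apply CV_radius_gt_of_ex_pseries with (Rabs x + 1).
- generalize (Rabs_pos x); intros; rewrite (Rabs_pos_eq (Rabs x + 1)); lra.
- eexists; apply is_exp_Reals.
Qed.

(** This is the defining recursion of the Bernoulli numbers divided by
    [(n + 1)!]. *)
Lemma bernoulli_egf_mult_expm1 (n : nat) :
  PS_mult bernoulli_egf expm1_coef n = if Nat.eqb n 0 then 1 else 0.
Proof.
destruct n as [|n].
- unfold PS_mult, bernoulli_egf, expm1_coef, PS_decr_1; cbn; field.
- cbn [Nat.eqb].
  rewrite <- (Rmult_0_r (/ INR (fact (S (S n))))).
  rewrite <- (bernoulli_rec (S n)) by lia.
  rewrite scal_sum; apply sum_eq; intros i Hi.
  unfold bernoulli_egf, expm1_coef, PS_decr_1, Binomial.C.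
  replace (S (S n) - i)%nat with (S (S n - i)) by lia.
  field; repeat split; apply INR_fact_neq_0.
Qed.

(** The subtracted term makes the bound inductive, since
    [2 / (m + 3)! <= 1 / (m + 2)!]. *)
Lemma sum_expm1_coef_le_1 (m : nat) :
  sum_f_R0 (fun j => expm1_coef (S j)) m <= 1 - / INR (fact (S (S m))).
Proof.
unfold expm1_coef, PS_decr_1.
induction m as [|m IH]; [cbn; lra|].
rewrite tech5.
assert (Hf := INR_fact_lt_0 (S (S m))).
rewrite (fact_simpl (S (S m))), mult_INR, Rinv_mult in *.
assert (Hm : / INR (S (S (S m))) <= / 2).
{ apply Rinv_le_contravar; [lra|].
  rewrite !S_INR; generalize (pos_INR m); lra. }
apply Rinv_0_lt_compat in Hf; nra.
Qed.

(** The recursion writes each coefficient as a combination of the earlier ones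
    with weights [1/2!, 1/3!, ...], whose sum is at most [1]. This crude
    bound suffices, as the generating function is only used near [0]. *)
Lemma bernoulli_egf_le_1 (n : nat) : Rabs (bernoulli_egf n) <= 1.
Proof.
induction n as [[|n] IH] using (well_founded_induction lt_wf).
- unfold bernoulli_egf; cbn; rewrite Rdiv_1_r, Rabs_R1; lra.
- assert (E := bernoulli_egf_mult_expm1 (S n)); unfold PS_mult in E.
  cbn [Nat.eqb] in E; rewrite tech5, Nat.sub_diag in E.
  replace (expm1_coef 0) with 1 in E
    by (unfold expm1_coef, PS_decr_1; cbn; field).
  rewrite Rmult_1_r in E.
  replace (bernoulli_egf (S n)) with
    (- sum_f_R0 (fun k => bernoulli_egf k * expm1_coef (S n - k)) n) by lra.
  rewrite Rabs_Ropp.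
  eapply Rle_trans; [apply Rsum_abs|].
  apply Rle_trans with (sum_f_R0 (fun j => expm1_coef (S j)) n).
  + rewrite <- (sum_f_R0_skip (fun j => expm1_coef (S j))).
    apply sum_Rle; intros k Hk.
    replace (S n - k)%nat with (S (n - k)) by lia.
    assert (Hpos : 0 < expm1_coef (S (n - k))).
    { apply Rinv_0_lt_compat, INR_fact_lt_0. }
    rewrite Rabs_mult, (Rabs_pos_eq (expm1_coef _)) by lra.
    specialize (IH k ltac:(lia)); nra.
  + generalize (sum_expm1_coef_le_1 n).
    generalize (Rinv_0_lt_compat _ (INR_fact_lt_0 (S (S n)))); lra.
Qed.

Lemma bernoulli_egf_radius (x : R) :
  Rabs x < 1 -> Rbar_lt (Rabs x) (CV_radius bernoulli_egf).
Proof.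
intros Hx; apply CV_radius_gt_of_bounded with 1 1; [exact Hx|].
intros n; rewrite pow1, Rmult_1_r; apply bernoulli_egf_le_1.
Qed.

Lemma PSeries_bernoulli (x : R) :
  Rabs x < 1 -> PSeries bernoulli_egf x * (exp x - 1) = x.
Proof.
intros Hx.
assert (E : PSeries bernoulli_egf x * PSeries expm1_coef x = 1).
{ rewrite <- PSeries_mult;
    [|now apply bernoulli_egf_radius|apply expm1_coef_radius].
  rewrite (PSeries_ext _ _ x bernoulli_egf_mult_expm1).
  exact (is_pseries_unique _ _ _ (is_pseries_monomial 0 x)). }
rewrite <- PSeries_expm1.
rewrite <- Rmult_assoc, (Rmult_comm _ x), Rmult_assoc, E; ring.
Qed.

(** Coefficients of [x + B(4x) - B(2x)], which is [x tanh x]. *)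
Definition bernoulli_tanh_coef (n : nat) : R :=
  (if Nat.eqb n 1 then 1 else 0) + (4 ^ n - 2 ^ n) * bernoulli_egf n.

Lemma is_pseries_bernoulli_tanh (x : R) :
  Rabs x < 1 / 4 ->
  is_pseries bernoulli_tanh_coef x
    (x + (PSeries bernoulli_egf (4 * x) - PSeries bernoulli_egf (2 * x))).
Proof.
intros Hx.
assert (Hscale : forall k : R, 0 <= k <= 4 ->
  is_series (fun n => bernoulli_egf n * (k * x) ^ n)
    (PSeries bernoulli_egf (k * x))).
{ intros k Hk; apply is_pseries_R, PSeries_correct, CV_radius_inside.
  apply bernoulli_egf_radius; rewrite Rabs_mult, (Rabs_pos_eq k) by lra.
  generalize (Rabs_pos x); nra. }
assert (H1 := proj1 (is_pseries_R _ _ _) (is_pseries_monomial 1 x)).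
rewrite pow_1 in H1.
assert (H42 := is_series_minus (V := R_NormedModule) _ _ _ _
                 (Hscale 4 ltac:(lra)) (Hscale 2 ltac:(lra))).
apply is_pseries_R.
refine (is_series_ext _ _ _ _ (is_series_plus (V := R_NormedModule) _ _ _ _ H1 H42)).
intros n; unfold bernoulli_tanh_coef; rewrite !Rpow_mult_distr.
change ((if Nat.eqb n 1 then 1 else 0) * x ^ n
        + (bernoulli_egf n * (4 ^ n * x ^ n) - bernoulli_egf n * (2 ^ n * x ^ n))
        = ((if Nat.eqb n 1 then 1 else 0) + (4 ^ n - 2 ^ n) * bernoulli_egf n)
          * x ^ n).
ring.
Qed.

(** Both sides are coefficients of [x tanh x] at [n + 1]. With [u = e^(2x)],
    [B(2x) = 2x / (u - 1)] and [B(4x) = 4x / (u^2 - 1)], so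
    [x + B(4x) - B(2x) = x - 2x / (u + 1) = x (u - 1) / (u + 1)]. *)
Lemma tanh_coef_bernoulli (n : nat) :
  (1 <= n)%nat ->
  tanh_coef n = (4 ^ S n - 2 ^ S n) * bernoulli_egf (S n).
Proof.
intros Hn.
transitivity (bernoulli_tanh_coef (S n));
  [|unfold bernoulli_tanh_coef; destruct n; [lia|cbn -[pow]; ring]].
change (tanh_coef n) with (PS_incr_1 tanh_coef (S n)).
apply PSeries_ext_recip.
- rewrite CV_radius_incr_1.
  rewrite <- Rabs_R0; apply tanh_coef_radius.
  rewrite Rabs_R0; generalize PI_RGT_0; lra.
- rewrite <- Rabs_R0; apply CV_radius_gt_of_ex_pseries with (1 / 8).
  + rewrite Rabs_R0, Rabs_pos_eq; lra.
  + eexists; apply is_pseries_bernoulli_tanh; rewrite Rabs_pos_eq; lra.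
- assert (Hs : locally 0 (fun x : R => Rabs x < 1 / 4)).
  { assert (H4 : 0 < 1 / 4) by lra.
    exists (mkposreal _ H4); intros y Hy.
    rewrite <- (Rminus_0_r y); exact Hy. }
  generalize (filter_and _ _ PSeries_tanh_near_0 Hs).
  apply filter_imp; intros x [Ht Hx].
  rewrite PSeries_incr_1, (is_pseries_unique _ _ _ (is_pseries_bernoulli_tanh x Hx)).
  assert (B2 := PSeries_bernoulli (2 * x)).
  assert (B4 := PSeries_bernoulli (4 * x)).
  rewrite Rabs_mult, Rabs_pos_eq in B2, B4 by lra.
  specialize (B2 ltac:(lra)); specialize (B4 ltac:(lra)).
  replace (4 * x) with (2 * x + 2 * x) in B4 at 2 by ring.
  rewrite exp_plus in B4.
  destruct (Req_dec x 0) as [->|Hx0]; [rewrite !Rmult_0_r; ring|].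
  assert (Hu := exp_pos (2 * x)).
  assert (Hu1 : exp (2 * x) <> 1).
  { intros Hu1; apply Hx0; rewrite <- exp_0 in Hu1; apply exp_inv in Hu1; lra. }
  revert Ht B2 B4 Hu Hu1.
  generalize (exp (2 * x)) (PSeries tanh_coef x)
    (PSeries bernoulli_egf (2 * x)) (PSeries bernoulli_egf (4 * x)).
  intros u h b2 b4 Ht B2 B4 Hu Hu1.
  replace h with ((u - 1) / (u + 1)) by (rewrite <- Ht; field; lra).
  replace b2 with (2 * x / (u - 1)) by (rewrite <- B2; field; lra).
  replace b4 with (4 * x / (u * u - 1)) by (rewrite <- B4; field; nra).
  field; repeat split; nra.
Qed.

Lemma tan_coef_bernoulli (k : nat) :
  tan_coef (2 * k + 1)
  = 2 ^ (2 * k + 2) * (2 ^ (2 * k + 2) - 1) * Rabs (bernoulli (2 * k + 2))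
    / INR (fact (2 * k + 2)).
Proof.
assert (Hf := INR_fact_lt_0 (2 * k + 2)).
transitivity (Rabs (tanh_coef (2 * k + 1))).
- unfold tanh_coef; rewrite Rabs_mult, pow_1_abs, Rmult_1_l, Rabs_pos_eq;
    [easy|apply tan_coef_ge_0].
- rewrite tanh_coef_bernoulli by lia.
  replace (S (2 * k + 1)) with (2 * k + 2)%nat by lia.
  unfold bernoulli_egf.
  assert (H1 : 1 <= 2 ^ (2 * k + 2)) by (apply pow_R1_Rle; lra).
  replace 4 with (2 * 2) by ring; rewrite Rpow_mult_distr.
  rewrite Rabs_mult, Rabs_div, (Rabs_pos_eq (INR _)), Rabs_pos_eq by nra.
  field; lra.
Qed.

(** * The Maclaurin series of phi *)

Definition sin_coef (n : nat) : R :=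
  if Nat.even n then 0 else sin_n (Nat.div2 n).

Lemma is_pseries_sin (x : R) : is_pseries sin_coef x (sin x).
Proof.
unfold sin; destruct (exist_sin x²) as [l Hl].
replace (x * l) with (0 + x * l) by ring.
apply is_pseries_odd_even.
- rewrite <- (Rmult_0_l ((x ^ 2) ^ 0)).
  apply (is_pseries_ext (PS_scal 0 (fun n => if Nat.eqb n 0 then 1 else 0))).
  { intros n; unfold sin_coef; rewrite Nat.even_even; apply Rmult_0_l. }
  apply (is_pseries_scal (V := R_NormedModule)); [apply Rmult_comm|].
  apply is_pseries_monomial.
- apply is_pseries_R.
  apply (is_series_ext (fun n => sin_n n * x² ^ n)).
  { intros n; unfold sin_coef.
    rewrite Nat.even_odd, Nat.add_1_r, Nat.div2_succ_double, Rsqr_pow2.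
    reflexivity. }
  now apply is_series_Reals.
Qed.

Definition phi_taylor_coef (n : nat) : R :=
  2 / 3 * sin_coef n + 1 / 3 * tan_coef n.

Lemma phi_taylor_coef_even (k : nat) : phi_taylor_coef (2 * k) = 0.
Proof.
unfold phi_taylor_coef, sin_coef.
rewrite Nat.even_even, tan_coef_even by now exists k.
ring.
Qed.

Lemma phi_taylor_coef_odd (k : nat) : phi_taylor_coef (2 * k + 1) = phi_coef k.
Proof.
unfold phi_taylor_coef, sin_coef, phi_coef, sin_n.
rewrite Nat.even_odd, tan_coef_bernoulli.
replace (Nat.div2 (2 * k + 1)) with k
  by now rewrite Nat.add_1_r, Nat.div2_succ_double.
field; split; apply INR_fact_neq_0.
Qed.

Lemma is_pseries_phi (x : R) :
  0 <= x < PI / 2 -> is_pseries phi_taylor_coef x (phi x).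
Proof.
intros Hx.
apply (is_pseries_plus (V := R_NormedModule)
         (PS_scal (2 / 3) sin_coef) (PS_scal (1 / 3) tan_coef));
  apply (is_pseries_scal (V := R_NormedModule)); try apply Rmult_comm.
- apply is_pseries_sin.
- now apply is_pseries_tan.
Qed.

Lemma phi_radius (x : R) :
  Rabs x < PI / 2 -> Rbar_lt (Rabs x) (CV_radius phi_taylor_coef).
Proof.
intros Hx; generalize (Rabs_pos x); intros H0.
apply CV_radius_gt_of_ex_pseries with ((Rabs x + PI / 2) / 2).
- rewrite (Rabs_pos_eq (_ / 2)); lra.
- eexists; apply is_pseries_phi; lra.
Qed.

(** To the right of [0], [phi] agrees with a power series that is smooth on both
    sides of [0], and whose derivatives are thus continuous at [0]. *)
Lemma right_lim_Derive_n_phi (k : nat) :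
  right_lim (Derive_n phi k) 0 / INR (fact k) = phi_taylor_coef k.
Proof.
assert (HP : 0 < PI / 2) by (generalize PI_RGT_0; lra).
rewrite (right_lim_correct _ _ (PSeries (PS_derive_n k phi_taylor_coef) 0)).
- rewrite PSeries_0; unfold PS_derive_n; cbn [Nat.add fact INR].
  field; apply INR_fact_neq_0.
- apply (filterlim_ext_loc (PSeries (PS_derive_n k phi_taylor_coef))).
  + exists (mkposreal _ HP); intros y Hy Hy0.
    assert (Hy1 : Rabs y < PI / 2) by (rewrite <- (Rminus_0_r y); exact Hy).
    rewrite <- Derive_n_PSeries by now apply phi_radius.
    apply Derive_n_ext_loc.
    rewrite Rabs_pos_eq in Hy1 by lra.
    generalize (filter_and _ _ (open_gt 0 y Hy0) (open_lt (PI / 2) y Hy1)).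
    apply filter_imp; intros t [Ht0 Ht1].
    apply is_pseries_unique, is_pseries_phi; lra.
  + refine (filterlim_filter_le_1 _ (filter_le_within (F := locally 0) _) _).
    apply continuity_pt_filterlim, PSeries_continuity.
    rewrite CV_radius_derive_n; apply phi_radius; now rewrite Rabs_R0.
Qed.

Lemma taylor_first_phi (n : nat) (x : R) :
  taylor_first phi n x = sum_n (fun k => phi_taylor_coef k * x ^ k) n.
Proof.
apply sum_n_ext; intros k; now rewrite right_lim_Derive_n_phi.
Qed.

Lemma left_lim_phi (c : R) : 0 < c < PI / 2 -> left_lim phi c = phi c.
Proof.
intros Hc; apply left_lim_correct.
refine (filterlim_filter_le_1 _ (filter_le_within (F := locally c) _) _).
apply (proj1 (continuity_pt_filterlim phi c)).
assert (Hcos : cos c <> 0) by (apply Rgt_not_eq, cos_gt_0; lra).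
apply continuity_pt_plus; apply continuity_pt_mult;
  try (apply continuity_pt_const; now intros ? ?).
- apply continuity_sin.
- apply continuity_pt_filterlim, continuous_tan, Hcos.
Qed.

(** * Signs of the coefficients *)

Lemma tan_coef_1 : tan_coef 1 = 1.
Proof. unfold tan_coef; cbn; field. Qed.

(** In the convolution giving [t_(2k+5)], the two extreme nonzero products are
    [t_1 t_(2k+3)] and [t_(2k+3) t_1]; the others are nonnegative. The index
    starts at [3] so that these are two distinct terms. *)
Lemma tan_coef_step (k : nat) :
  2 * tan_coef (2 * k + 3) <= INR (2 * k + 5) * tan_coef (2 * k + 5).
Proof.
replace (2 * k + 5)%nat with (S (S (S (S (2 * k + 1))))) by lia.
replace (2 * k + 3)%nat with (S (S (2 * k + 1))) by lia.
rewrite tan_coef_rec, Rplus_0_l, Rmult_1_l; unfold PS_mult.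
rewrite 2!tech5, 2!decomp_sum by lia.
rewrite Nat.sub_diag, Nat.sub_0_r, (Nat.sub_succ_l (S (S (2 * k + 1)))) by lia.
rewrite Nat.sub_diag, Nat.sub_succ, Nat.sub_0_r, tan_coef_1.
match goal with |- _ <= _ + (_ + ?A) + _ + _ => assert (HA : 0 <= A) end.
{ apply cond_pos_sum; intros i; apply Rmult_le_pos; apply tan_coef_ge_0. }
replace (tan_coef 0) with 0 by reflexivity; lra.
Qed.

(** At [k = 0] the value is [5! * 2/15 = 16]; then [tan_coef_step] multiplies
    it by at least [2 (2k + 6)] at each step. *)
Lemma fact_mul_tan_coef_gt_2 (k : nat) :
  2 < INR (fact (2 * k + 5)) * tan_coef (2 * k + 5).
Proof.
induction k as [|k IH].
- unfold tan_coef; cbn -[INR]; simpl INR; lra.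
- assert (H := tan_coef_step (S k)).
  replace (2 * S k + 3)%nat with (2 * k + 5)%nat in H by lia.
  replace (2 * S k + 5)%nat with (S (S (2 * k + 5))) in * by lia.
  rewrite !fact_simpl, !mult_INR.
  set (f := INR (fact (2 * k + 5))) in *.
  set (t := tan_coef (2 * k + 5)) in *.
  set (u := tan_coef (S (S (2 * k + 5)))) in *.
  set (m := INR (S (S (2 * k + 5)))) in *.
  assert (H1 : 1 <= INR (S (2 * k + 5))).
  { rewrite S_INR; generalize (pos_INR (2 * k + 5)); lra. }
  assert (Hf : 0 < f) by apply INR_fact_lt_0.
  assert (H2 : 2 * (f * t) <= f * (m * u)) by nra.
  replace (m * (INR (S (2 * k + 5)) * f) * u)
    with (INR (S (2 * k + 5)) * (f * (m * u))) by ring.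
  nra.
Qed.

(** Times [(2k+5)!], the sine part is [2/3] or [-2/3], while the tangent part
    exceeds [2/3]. *)
Lemma phi_taylor_coef_pos (k : nat) : 0 < phi_taylor_coef (2 * k + 5).
Proof.
assert (H := fact_mul_tan_coef_gt_2 k).
assert (Hf := INR_fact_lt_0 (2 * k + 5)).
apply Rmult_lt_reg_l with (INR (fact (2 * k + 5))); [exact Hf|].
rewrite Rmult_0_r; unfold phi_taylor_coef.
enough (Hs : -1 <= INR (fact (2 * k + 5)) * sin_coef (2 * k + 5)) by lra.
replace (2 * k + 5)%nat with (S (2 * (k + 2)))%nat in * by lia.
unfold sin_coef, sin_n.
rewrite Nat.div2_succ_double, <- Nat.add_1_r in *; rewrite Nat.even_odd.
replace (INR _ * (_ / _)) with ((-1) ^ (k + 2)) by (field; lra).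
generalize (pow_1_abs (k + 2)); unfold Rabs; destruct Rcase_abs; lra.
Qed.

Lemma phi_taylor_coef_ge_0 (n : nat) : 0 <= phi_taylor_coef n.
Proof.
destruct (Nat.Even_or_Odd n) as [[k ->]|[k ->]].
- rewrite phi_taylor_coef_even; lra.
- destruct k as [|[|k]].
  + unfold phi_taylor_coef, sin_coef, sin_n, tan_coef; cbn; lra.
  + unfold phi_taylor_coef, sin_coef, sin_n, tan_coef; cbn; lra.
  + replace (2 * S (S k) + 1)%nat with (2 * k + 5)%nat by lia.
    apply Rlt_le, phi_taylor_coef_pos.
Qed.

Lemma phi_taylor_coef_pos_iff (n : nat) :
  0 < phi_taylor_coef (S n) <-> Nat.Even n /\ n <> 2%nat.
Proof.
destruct (Nat.Even_or_Odd n) as [[k ->]|[k ->]].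
- destruct k as [|[|k]].
  + unfold phi_taylor_coef, sin_coef, sin_n, tan_coef; cbn.
    split; [split; [now exists 0%nat|lia]|lra].
  + unfold phi_taylor_coef, sin_coef, sin_n, tan_coef; cbn.
    split; [lra|intros [_ H]; now destruct H].
  + replace (S (2 * S (S k))) with (2 * k + 5)%nat by lia.
    split; [|intros _; apply phi_taylor_coef_pos].
    split; [now exists (S (S k))|lia].
- replace (S (2 * k + 1)) with (2 * S k)%nat by lia.
  rewrite phi_taylor_coef_even.
  split; [lra|intros [[j Hj] _]; lia].
Qed.

(** * Taylor approximations from below and from above *)

(** [taylor_below n] is the Taylor polynomial of order [n - 1]. The convention
    that it is [0] for [n = 0] brings the two cases of [taylor_second] under one
    formula. *)
Definition taylor_below (n : nat) (x : R) : R :=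
  match n with O => 0 | S m => taylor_first phi m x end.

Lemma is_series_taylor_below_remainder (n : nat) (x : R) :
  0 <= x < PI / 2 ->
  is_series (fun k => phi_taylor_coef (n + k) * x ^ (n + k))
    (phi x - taylor_below n x).
Proof.
intros Hx.
assert (H := proj1 (is_pseries_R _ _ _) (is_pseries_phi x Hx)).
destruct n as [|n]; cbn [taylor_below].
- now rewrite Rminus_0_r.
- apply (is_series_incr_n (fun k => phi_taylor_coef k * x ^ k) (S n));
    [lia|cbn [Nat.pred]].
  rewrite <- taylor_first_phi.
  change (plus (phi x - taylor_first phi n x) (taylor_first phi n x))
    with (phi x - taylor_first phi n x + taylor_first phi n x).
  replace (phi x - taylor_first phi n x + taylor_first phi n x)
    with (phi x) by ring.
  exact H.
Qed.

Lemma taylor_second_phi (c : R) (n : nat) (x : R) :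
  0 < c < PI / 2 ->
  taylor_second phi c n x
  = taylor_below n x + (phi c - taylor_below n c) / c ^ n * x ^ n.
Proof.
intros Hc; destruct n as [|n]; unfold taylor_second;
  rewrite left_lim_phi by exact Hc; [cbn; field|reflexivity].
Qed.

(** The remainder contains the term of odd degree [2n + 5 >= n], whose
    coefficient is positive. *)
Lemma taylor_below_lt_phi (n : nat) (x : R) :
  0 < x < PI / 2 -> taylor_below n x < phi x.
Proof.
intros Hx; apply Rlt_0_minus.
apply (is_series_pos _ _ (n + 5)
         (is_series_taylor_below_remainder n x ltac:(lra))).
- intros k; apply Rmult_le_pos; [apply phi_taylor_coef_ge_0|apply pow_le; lra].
- replace (n + (n + 5))%nat with (2 * n + 5)%nat by lia.
  apply Rmult_lt_0_compat; [apply phi_taylor_coef_pos|apply pow_lt; lra].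
Qed.

(** Multiplying the remainder series at [c] by [(x / c)^n] and subtracting the
    one at [x] leaves the terms [a_(n+k) x^n (c^k - x^k)]. The one with
    [k = n + 5] is positive. *)
Lemma phi_lt_taylor_second (c x : R) (n : nat) :
  0 < c < PI / 2 -> 0 < x < c -> phi x < taylor_second phi c n x.
Proof.
intros Hc Hx; rewrite taylor_second_phi by exact Hc.
assert (Hcn : 0 < c ^ n) by (apply pow_lt; lra).
assert (Hxn : 0 < x ^ n) by (apply pow_lt; lra).
assert (Sc := is_series_taylor_below_remainder n c ltac:(lra)).
assert (Sx := is_series_taylor_below_remainder n x ltac:(lra)).
assert (Sd := is_series_minus (V := R_NormedModule) _ _ _ _
   (is_series_scal (V := R_NormedModule) (x ^ n / c ^ n) _ _ Sc) Sx).
assert (E : forall k,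
  x ^ n / c ^ n * (phi_taylor_coef (n + k) * c ^ (n + k))
  - phi_taylor_coef (n + k) * x ^ (n + k)
  = phi_taylor_coef (n + k) * (x ^ n * (c ^ k - x ^ k))).
{ intros k; rewrite !pow_add; field; lra. }
enough (0 < x ^ n / c ^ n * (phi c - taylor_below n c)
            - (phi x - taylor_below n x)) as H.
{ replace ((phi c - taylor_below n c) / c ^ n * x ^ n)
    with (x ^ n / c ^ n * (phi c - taylor_below n c)) by (field; lra).
  lra. }
apply (is_series_pos _ _ (n + 5) (is_series_ext _ _ _ E Sd)).
- intros k; apply Rmult_le_pos; [apply phi_taylor_coef_ge_0|].
  apply Rmult_le_pos; [lra|].
  assert (x ^ k <= c ^ k) by (apply pow_incr; lra); lra.
- replace (n + (n + 5))%nat with (2 * n + 5)%nat by lia.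
  apply Rmult_lt_0_compat; [apply phi_taylor_coef_pos|].
  apply Rmult_lt_0_compat; [exact Hxn|].
  assert (x ^ (n + 5) < c ^ (n + 5)).
  { rewrite Nat.add_succ_r; cbn [pow].
    assert (x ^ (n + 4) <= c ^ (n + 4)) by (apply pow_incr; lra).
    assert (0 < c ^ (n + 4)) by (apply pow_lt; lra).
    nra. }
  lra.
Qed.

(** The difference equals
    [(phi c - T_n(c)) * (x / c)^n * (1 - x / c)], and [phi c] exceeds
    [T_n(c)]. *)
Lemma taylor_second_decreasing (c x : R) (n : nat) :
  0 < c < PI / 2 -> 0 < x < c ->
  taylor_second phi c (S n) x < taylor_second phi c n x.
Proof.
intros Hc Hx; rewrite !taylor_second_phi by exact Hc.
assert (Hcn : 0 < c ^ n) by (apply pow_lt; lra).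
assert (Hxn : 0 < x ^ n) by (apply pow_lt; lra).
assert (Hlt := taylor_below_lt_phi (S n) c Hc).
assert (E : forall y,
  taylor_below (S n) y = taylor_below n y + phi_taylor_coef n * y ^ n).
{ intros y; cbn [taylor_below]; destruct n as [|n]; cbn [taylor_below];
    rewrite !taylor_first_phi.
  - rewrite sum_O; ring.
  - now rewrite sum_Sn. }
rewrite !E in *.
set (r := phi c - (taylor_below n c + phi_taylor_coef n * c ^ n)).
apply Rlt_0_minus.
replace (_ - _) with (r * (x ^ n / c ^ n) * ((c - x) / c))
  by (unfold r; cbn [pow]; field; lra).
unfold r; repeat apply Rmult_lt_0_compat; try lra;
  apply Rinv_0_lt_compat; lra.
Qed.

Theorem theorem6 :
  (forall x : R, 0 < x < PI / 2 ->
     is_series (fun k : nat => phi_coef k * x ^ (2 * k + 1)) (phi x))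
  /\
  (forall c : R, 0 < c < PI / 2 -> forall x : R, 0 < x < c ->
     (forall n : nat, taylor_first phi n x <= taylor_first phi (S n) x)
     /\ (forall n : nat,
           taylor_first phi n x < taylor_first phi (S n) x
           <-> Nat.Even n /\ n <> 2%nat)
     /\ (forall n : nat, taylor_first phi n x < phi x)
     /\ (forall n : nat, phi x < taylor_second phi c n x)
     /\ (forall n : nat,
           taylor_second phi c (S n) x < taylor_second phi c n x)).
Proof.
split.
- intros x Hx.
  apply (is_series_ext
           (fun k => phi_taylor_coef (2 * k + 1) * x ^ (2 * k + 1))).
  { intros k; now rewrite phi_taylor_coef_odd. }
  apply (is_series_odd_terms (fun n => phi_taylor_coef n * x ^ n)).
  + intros k; rewrite phi_taylor_coef_even; ring.
  + apply is_pseries_R, is_pseries_phi; lra.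
- intros c Hc x Hx.
  assert (Hstep : forall n, taylor_first phi (S n) x
    = taylor_first phi n x + phi_taylor_coef (S n) * x ^ S n).
  { intros n; rewrite !taylor_first_phi; now rewrite sum_Sn. }
  assert (Hxn : forall n, 0 < x ^ n) by (intros n; apply pow_lt; lra).
  split; [|split; [|split; [|split]]]; intros n.
  + rewrite Hstep.
    generalize (phi_taylor_coef_ge_0 (S n)) (Hxn (S n)); nra.
  + rewrite <- phi_taylor_coef_pos_iff, Hstep.
    specialize (Hxn (S n)); split; intros H; nra.
  + apply (taylor_below_lt_phi (S n)); lra.
  + now apply phi_lt_taylor_second.
  + now apply taylor_second_decreasing.
Qed.
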